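(* Let $\ell_1,\ell_2,\xi_1,\xi_2,\eta_1,\eta_2,\kappa>0$ and $M_1,M_2\in\mathbb{R}$, and consider the two-link swimmer control system (S) defined in the context. (i) If $\eta_1-\xi_1=\eta_2-\xi_2=0$, then there exist two constants $x^0,y^0$, depending on the initial condition of the state but not on the control $(H_\parallel,H_\perp)$, such that the solutions of (S) satisfy, for all $t$, $$x(t)=x^0+\frac{\eta_1\ell_1\bigl(\ell_1\cos(\alpha(t)+\theta(t))+\ell_2\cos\theta(t)\bigr)}{2(\eta_1\ell_1+\eta_2\ell_2)},$$ $$y(t)=y^0+\frac{\eta_1\ell_1\bigl(\ell_1\sin(\alpha(t)+\theta(t))+\ell_2\sin\theta(t)\bigr)}{2(\eta_1\ell_1+\eta_2\ell_2)}.$$ (ii) If $$\Bigl(3+4\tfrac{\ell_2}{\ell_1}+\tfrac{\eta_2\ell_2^2}{\eta_1\ell_1^2}\Bigr)M_1-\Bigl(3+4\tfrac{\ell_1}{\ell_2}+\tfrac{\eta_1\ell_1^2}{\eta_2\ell_2^2}\Bigr)M_2=0,$$ then the set $\{\alpha=0\}$ is invariant for (S): for any control, any solution with $\alpha(0)=0$ satisfies $\alpha(t)=0$ for all $t$.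
   Context: Write $\mathbf{R}_\varphi=\begin{pmatrix}\cos\varphi&-\sin\varphi\\ \sin\varphi&\cos\varphi\end{pmatrix}$, and let $\mathbf{I}_2$ be the $2\times2$ identity matrix. For positive parameters $\ell_i,\xi_i,\eta_i$ ($i=1,2$) define $$\mathbf{E}(\alpha)=\begin{pmatrix} -(\xi_1\ell_1+\xi_2\ell_2)\cos\alpha & -(\xi_1\ell_1+\eta_2\ell_2)\sin\alpha & \frac12\xi_1\ell_1\ell_2\sin\alpha & 0\\ (\eta_1\ell_1+\xi_2\ell_2)\sin\alpha & -(\eta_1\ell_1+\eta_2\ell_2)\cos\alpha & \frac12\eta_1\ell_1(\ell_1+\ell_2\cos\alpha) & \frac12\eta_1\ell_1^2\\ -\frac12\eta_1\ell_1^2\sin\alpha & \frac12(\eta_1\ell_1^2\cos\alpha-\eta_2\ell_2^2) & -\eta_1\ell_1^2\bigl(\frac14\ell_2\cos\alpha+\frac13\ell_1\bigr)-\frac1{12}\eta_2\ell_2^3 & -\frac13\eta_1\ell_1^3\\ 0 & -\frac12\eta_2\ell_2^2 & -\frac1{12}\eta_2\ell_2^3 & 0 \end{pmatrix}$$ and $$\mathbf{M}^h(\theta,\alpha)=\begin{pmatrix}\mathbf{R}_{\theta+\alpha}&0\\0&\mathbf{I}_2\end{pmatrix}\mathbf{E}(\alpha)\begin{pmatrix}\mathbf{R}_{-\theta}&0\\0&\mathbf{I}_2\end{pmatrix}.$$ These matrices are invertible for all $\theta,\alpha$. The two-link magneto-elastic swimmer control system, with state $\mathbf{z}=(x,y,\theta,\alpha)\in\mathbb{R}^2\times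 S^1\times S^1$ and (measurable, locally bounded) controls $H_\parallel,H_\perp$, is $$\text{(S)}\qquad \mathbf{M}^h(\theta,\alpha)\begin{pmatrix}\dot x\\\dot y\\\dot\theta\\\dot\alpha\end{pmatrix}=\begin{pmatrix}0\\0\\-M_1(\cos\alpha\,H_\perp-\sin\alpha\,H_\parallel)-M_2H_\perp\\-\kappa\alpha-M_2H_\perp\end{pmatrix}.$$ Solutions are absolutely continuous curves satisfying (S) for almost every $t$. In the term $\kappa\alpha$, $\alpha(t)$ is the continuous real-valued determination of the angle with initial value in $(-\pi,\pi]$. *)

(* Defs.v *)
From mathcomp Require Import all_boot all_order all_algebra.
From mathcomp Require Import all_classical all_reals all_analysis.
From mathcomp Require Import measurable_realfun.

Set Implicit Arguments.
Unset Strict Implicit.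
Unset Printing Implicit Defensive.

Import Order.TTheory GRing.Theory Num.Theory.
Import numFieldNormedType.Exports.

Local Open Scope classical_set_scope.
Local Open Scope ring_scope.

Definition mx_of_rows (R : realType) (m n : nat) (rows : seq (seq R)) :
    'M[R]_(m, n) :=
  \matrix_(i < m, j < n) (nth [::] rows i)`_j.

Definition rot (R : realType) (phi : R) : 'M[R]_2 :=
  mx_of_rows 2 2 [:: [:: cos phi; - sin phi];
                     [:: sin phi;   cos phi]].

Definition Emx (R : realType) (l1 l2 xi1 xi2 eta1 eta2 : R) (alpha : R) :
    'M[R]_4 :=
  mx_of_rows 4 4
    [:: [:: - (xi1 * l1 + xi2 * l2) * cos alpha;
            - (xi1 * l1 + eta2 * l2) * sin alpha;
            2^-1 * xi1 * l1 * l2 * sin alpha;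
            0];
        [:: (eta1 * l1 + xi2 * l2) * sin alpha;
            - (eta1 * l1 + eta2 * l2) * cos alpha;
            2^-1 * eta1 * l1 * (l1 + l2 * cos alpha);
            2^-1 * eta1 * l1 ^+ 2];
        [:: - (2^-1 * eta1 * l1 ^+ 2 * sin alpha);
            2^-1 * (eta1 * l1 ^+ 2 * cos alpha - eta2 * l2 ^+ 2);
            - (eta1 * l1 ^+ 2) * (4^-1 * l2 * cos alpha + 3^-1 * l1)
              - 12^-1 * eta2 * l2 ^+ 3;
            - (3^-1 * eta1 * l1 ^+ 3)];
        [:: 0;
            - (2^-1 * eta2 * l2 ^+ 2);
            - (12^-1 * eta2 * l2 ^+ 3);
            0]].

Definition Mh (R : realType) (l1 l2 xi1 xi2 eta1 eta2 : R) (theta alpha : R) :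
    'M[R]_(2 + 2) :=
  block_mx (rot (theta + alpha)) 0 0 1%:M
    *m Emx l1 l2 xi1 xi2 eta1 eta2 alpha
    *m block_mx (rot (- theta)) 0 0 1%:M.

Definition swimmer_rhs (R : realType) (kappa M1 M2 : R)
    (alpha hpar hperp : R) : 'cV[R]_(2 + 2) :=
  mx_of_rows 4 1
    [:: [:: 0];
        [:: 0];
        [:: - M1 * (cos alpha * hperp - sin alpha * hpar) - M2 * hperp];
        [:: - kappa * alpha - M2 * hperp]].

Definition abs_continuous_on (R : realType) (a b : R) (f : R -> R) : Prop :=
  forall eps : R, 0 < eps -> exists2 delta : R, 0 < delta &
    forall (n : nat) (u v : 'I_n -> R),
      (forall i, a <= u i /\ u i <= v i /\ v i <= b) ->
      trivIset setT (fun i => `]u i, v i[%classic) ->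
      \sum_(i < n) (v i - u i) < delta ->
      \sum_(i < n) `|f (v i) - f (u i)| < eps.

(* When I is an interval this is absolute continuity on every compact
   subinterval of I, hence plain absolute continuity when I is compact. *)
Definition abs_continuous_curve (R : realType) (I : set R) (f : R -> R) :
    Prop :=
  forall a b : R, I a -> I b -> a <= b -> abs_continuous_on a b f.

(* [completed_algebra_gen lebesgue_measure] is the sigma-algebra of
   Lebesgue-measurable sets; [measurable_fun] would only allow controls that
   are Borel-measurable. *)
Definition lebesgue_measurable_on (R : realType) (I : set R) (f : R -> R) :
    Prop :=
  forall B : set R, measurable B ->
    completed_algebra_gen (@lebesgue_measure R) (I `&` f @^-1` B).

Definition admissible_control (R : realType) (I : set R) (h : R -> R) : Prop :=
  lebesgue_measurable_on I h /\ [locally [bounded h t | t in I]].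

(* The curve (x, y, theta, alpha) in R^2 * S^1 * S^1, defined on the time
   interval I containing the initial time 0, is given by continuous real
   determinations of the two angles. System (S) depends on theta only through
   its class modulo 2 pi, so any determination of theta is allowed; the term
   kappa * alpha requires the one of alpha to start in ]-pi, pi]. *)
Definition swimmer_solution (R : realType)
    (l1 l2 xi1 xi2 eta1 eta2 kappa M1 M2 : R) (I : set R)
    (Hpar Hperp : R -> R) (x y theta alpha : R -> R) : Prop :=
  [/\ is_interval I /\ I 0,
      admissible_control I Hpar /\ admissible_control I Hperp,
      [/\ abs_continuous_curve I x, abs_continuous_curve I y,
          abs_continuous_curve I theta & abs_continuous_curve I alpha],
      - pi < alpha 0 <= pi &
      {ae (@lebesgue_measure R), forall t : R, I t ->
        [/\ derivable x t 1, derivable y t 1,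
            derivable theta t 1, derivable alpha t 1 &
            Mh l1 l2 xi1 xi2 eta1 eta2 (theta t) (alpha t)
              *m mx_of_rows 4 1 [:: [:: derive1 x t]; [:: derive1 y t];
                                    [:: derive1 theta t]; [:: derive1 alpha t]]
            = swimmer_rhs kappa M1 M2 (alpha t) (Hpar t) (Hperp t)]}].

Definition same_angle (R : realType) (a b : R) : Prop :=
  exists k : int, a = b + k%:~R * (2 * pi).

Definition starts_at (R : realType) (x y theta alpha : R -> R)
    (xi yi thetai alphai : R) : Prop :=
  [/\ x 0 = xi, y 0 = yi,
      same_angle (theta 0) thetai & same_angle (alpha 0) alphai].

(* Main.v *)
Require Import Defs.
From mathcomp Require Import all_boot all_order all_algebra.
From mathcomp Require Import all_classical all_reals all_analysis.
From mathcomp Require Import measurable_realfun ring lra.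

Import Order.TTheory GRing.Theory Num.Theory.
Import numFieldNormedType.Exports.

Local Open Scope classical_set_scope.
Local Open Scope ring_scope.

(** Both parts compare a solution with a differential relation that holds only
    almost everywhere, so they rest on one fact about absolutely continuous
    functions: a bound on the derivative almost everywhere is a Lipschitz bound
    ([ac_lipschitz_ae]). It follows from the monotone case
    [ac_nonincreasing], which is proved without integration: an open set of
    small measure covers the bad times, absolute continuity controls the
    variation over finitely many disjoint intervals inside it, the derivative
    controls the growth elsewhere, and the two kinds of steps are glued along
    the segment by a supremum argument ([real_induction]).

    Undoing the rotations turns the system into four scalar equations for the
    velocity (u, v) of the centre of the second link in the frame of that link
    and for the two angular velocities ([balance]).

    In the isotropic case the zero total force makes the drag-weighted mean of
    the velocities of the two link midpoints vanish, whatever the torques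
    ([isotropic_velocity]). This mean is the derivative of the centre position
    minus an explicit function of the angles, so that difference is constant in
    time ([isotropic_position]); its value is read off the initial state, which
    fixes the angles modulo 2 pi only.

    For the invariance of the straight shape the goal is a bound
    |alpha'| <= C |alpha| almost everywhere, after which Gronwall's inequality
    ([gronwall_sqr]) concludes. A fixed combination of the equations isolates
    alpha' at the straight shape, and the condition on M1 and M2 is what makes
    the controls drop out of it there; away from the straight shape it leaves
    terms that contain a factor of size |alpha| ([shape_rate]). These factors
    multiply velocities, which are bounded by the torques because the power
    dissipated by the drag is a positive definite quadratic form
    ([velocity_bound]). Controls are bounded on compact time intervals
    ([locally_bounded_segment]), so C is finite. *)

Set Implicit Arguments.
Unset Strict Implicit.
Unset Printing Implicit Defensive.

(** * Absolutely continuous functions and their derivative *)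

(** Induction along a segment: the supremum of the points reached is itself
    reached by a step from the left, and a step to the right goes beyond it. *)
Lemma real_induction (R : realType) (a b : R) (P : R -> Prop) :
  a <= b -> P a ->
  (forall x, a <= x <= b -> exists2 d, 0 < d &
     (forall s, a <= s <= x -> x - d < s -> P s -> P x) /\
     (forall t, x <= t <= b -> t < x + d -> P x -> P t)) ->
  P b.
Proof.
move=> leab Pa step.
pose S := [set t : R | a <= t <= b /\ P t].
have Sa : S a by split; rewrite ?lexx.
have ubS : ubound S b by move=> t [/andP[]].
have supS : has_sup S by split; [exists a | exists b].
have le_as : a <= sup S by apply: ub_le_sup; [exists b|].
have le_sb : sup S <= b by apply: ge_sup; [exists a|].
have [d d0 [stepl stepr]] := step (sup S) ltac:(by rewrite le_as le_sb).
have [s [/andP[as_ sb] Ps] lts] := sup_adherent d0 supS.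
have Psup : P (sup S).
  apply: (stepl _ _ lts Ps); rewrite as_ /=.
  by apply: ub_le_sup; [exists b|split; rewrite ?as_].
move: le_sb; rewrite le_eqVlt => /predU1P[<-//|ltsb].
pose t := Order.min b (sup S + d / 2).
have lt_st : sup S < t by rewrite lt_min ltsb ltrDl divr_gt0.
have letb : t <= b by rewrite ge_min lexx.
have St : S t.
  split; first by rewrite letb andbT (le_trans le_as)// ltW.
  apply: stepr Psup; first by rewrite letb ltW.
  by rewrite gt_min ltrD2l; apply/orP; right; lra.
by have := ub_le_sup (ex_intro _ _ ubS) St; rewrite leNgt lt_st.
Qed.

(** Only increments with one end at x are compared: a point where the
    derivative exists gives nothing about pairs of points near it. *)
Lemma is_derive_le0_slope (R : realType) (f : R -> R) (x d eps : R) :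
  is_derive x (1 : R) f d -> d <= 0 -> 0 < eps ->
  exists2 e, 0 < e &
    (forall s, s <= x -> x - e < s -> f x - f s <= eps * (x - s)) /\
    (forall t, x <= t -> t < x + e -> f t - f x <= eps * (t - x)).
Proof.
move=> [/cvg_ex[/= l fl] fd] d0 eps0.
have ld : l = d.
  by rewrite -fd; apply/esym/cvg_lim.
move/cvgrPdist_lt/(_ _ eps0): fl; rewrite ld => -[e /= e0 He].
exists e => //.
have key (h : R) : `|h| < e -> h != 0 -> h^-1 * (f (h + x) - f x) < eps.
  move=> he h0; have := He h; rewrite /ball/= sub0r normrN => /(_ he h0).
  rewrite /GRing.scale/= mulr1 ltr_norml => /andP[].
  by set q := _^-1 * _; lra.
split=> [s sx xs|t xt tx].
- have [->|nsx] := eqVneq s x; first by lra.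
  have s0 : 0 < x - s by rewrite subr_gt0 lt_neqAle nsx.
  have := key (s - x); rewrite subrK subr_eq0 => /(_ _ nsx).
  rewrite distrC gtr0_norm// ltrBlDl -ltrBlDr => /(_ xs).
  rewrite -[s - x]opprB -[f s - _]opprB invrN mulrNN ltr_pdivrMl// mulrC.
  exact: ltW.
- have [->|nxt] := eqVneq t x; first by lra.
  have t0 : 0 < t - x by rewrite subr_gt0 lt_neqAle eq_sym nxt.
  have := key (t - x); rewrite subrK subr_eq0 => /(_ _ nxt).
  rewrite gtr0_norm// ltrBlDl => /(_ tx); rewrite ltr_pdivrMl// mulrC.
  exact: ltW.
Qed.

(** Allow f to grow at rate eps at the good times; what is missing is paid by
    the variation of f over finitely many disjoint intervals contained in an
    open set of measure less than delta, hence is less than eps. *)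
Lemma ac_nonincreasing (R : realType) (f : R -> R) (a b : R) :
  a <= b -> abs_continuous_on a b f ->
  {ae (@lebesgue_measure R), forall t, a <= t <= b ->
     exists2 d : R, is_derive t (1 : R) f d & d <= 0} ->
  f b <= f a.
Proof.
move=> leab acf [N [mN N0 subN]].
apply/ler_addgt0Pr => e0 e0_gt0.
pose eps := e0 / (b - a + 1).
have eps_gt0 : 0 < eps by rewrite divr_gt0//; lra.
have [delta delta_gt0 acd] := acf _ eps_gt0.
have muN : (lebesgue_measure N < +oo)%E by rewrite N0 ltry.
have [U [openU NU muU]] := lebesgue_regularity_outer mN muN delta_gt0.
have {}muU : (lebesgue_measure U < delta%:E)%E.
  have mU := open_measurable openU.
  by rewrite -(setDKU NU) measureU0//; exact: measurableD.
(* f has been followed from a to t, with the excess growth recorded on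
   intervals that stay inside U. *)
pose P t := exists n (u v : 'I_n -> R),
  [/\ forall i, a <= u i /\ u i <= v i /\ v i <= t,
      trivIset setT (fun i => `]u i, v i[%classic),
      forall i, `]u i, v i[%classic `<=` U &
      f t - f a <= eps * (t - a) + \sum_(i < n) (f (v i) - f (u i))].
have stepU s t : a <= s -> s <= t -> `]s, t[%classic `<=` U -> P s -> P t.
  move=> as_ st stU [n [u [v [uv triv sub le]]]].
  exists n.+1, (fun i => oapp u s (unlift ord0 i)),
    (fun i => oapp v t (unlift ord0 i)).
  split=> [i|i j _ _|i|].
  - case: unliftP => [j|] _ /=; last by lra.
    by have [? []] := uv j; split => //; split => //; lra.
  - case: unliftP => [i'|] -> /=; case: unliftP => [j'|] -> //=.
    + by move=> /triv -> //.
    + have [_ [_ vs]] := uv i'; move=> [z [/=]]; rewrite !in_itv/=.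
      by move=> /andP[_ zv] /andP[sz _]; exfalso; lra.
    + have [_ [_ vs]] := uv j'; move=> [z [/=]]; rewrite !in_itv/=.
      by move=> /andP[sz _] /andP[_ zv]; exfalso; lra.
  - by case: unliftP => [j|] _ //=.
  - rewrite big_ord_recl unlift_none /=.
    under eq_bigr do rewrite liftK /=.
    have : eps * (s - a) <= eps * (t - a) by rewrite ler_pM2l//; lra.
    move: le; set S := \sum_(i < n) _; lra.
have stepD s t : a <= s -> s <= t -> f t - f s <= eps * (t - s) -> P s -> P t.
  move=> as_ st le1 [n [u [v [uv triv sub le]]]].
  exists n, u, v; split => // [i|].
    by have [? []] := uv i; split => //; split => //; lra.
  have : eps * (t - a) = eps * (t - s) + eps * (s - a) by ring.
  move: le; set S := \sum_(i < n) _; lra.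
have Pb : P b.
  apply: (@real_induction _ _ _ P leab).
    exists 0%N, (fun=> 0), (fun=> 0); split => [[]//|[]//|[]//|].
    by rewrite big_ord0; lra.
  move=> x /andP[ax xb].
  have [Ux|nUx] := pselect (U x).
    have [e /= e_gt0 He] := openU x Ux.
    exists e => //; split => [s /andP[as_ sx] xs|t /andP[xt tb] tx].
    - apply: stepU => // z /=; rewrite in_itv/= => /andP[sz zx].
      by apply: He; rewrite /ball/= ltr_norml; lra.
    - apply: stepU => // z /=; rewrite in_itv/= => /andP[sz zx].
      by apply: He; rewrite /ball/= ltr_norml; lra.
  have [d fd d_le0] : exists2 d : R, is_derive x (1 : R) f d & d <= 0.
    apply: contrapT => nd; apply: nUx; apply: NU; apply: subN => /= H.
    by apply/nd/H; rewrite ax.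
  have [e e_gt0 [el er]] := is_derive_le0_slope fd d_le0 eps_gt0.
  exists e => //; split => [s /andP[as_ sx] xs|t /andP[xt tb] tx].
  - by apply: stepD => //; exact: el.
  - by apply: stepD => //; exact: er.
case: Pb => n [u [v [uv triv sub le]]].
have sum_lt : \sum_(i < n) (v i - u i) < delta.
  rewrite -lte_fin; apply: le_lt_trans muU.
  have mI i : measurable (`]u i, v i[%classic : set R) by exact: measurable_itv.
  have mE i : (lebesgue_measure `]u i, v i[%classic = (v i - u i)%:E)%E.
    rewrite lebesgue_measure_itv/= lte_fin; have [_ [le_uv _]] := uv i.
    have [//|ge_uv] := ltP (u i) (v i).
    by rewrite (@le_anti _ _ (u i) (v i)) ?subrr ?le_uv.
  have -> : ((\sum_(i < n) (v i - u i))%:E =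
      lebesgue_measure (\big[setU/set0]_(i < n) `]u i, v i[%classic))%E.
    rewrite measure_bigsetU_ord// -sumEFin; apply: eq_bigr => i _.
    exact/esym/mE.
  apply: le_measure; rewrite ?inE.
  - exact: bigsetU_measurable.
  - exact: open_measurable.
  - apply: (big_ind (fun A => A `<=` U)) => [|A B AU BU|i _].
    + exact: sub0set.
    + by rewrite subUset.
    + exact: sub.
have sum_f : \sum_(i < n) (f (v i) - f (u i)) < eps.
  apply: le_lt_trans (acd n u v uv triv sum_lt).
  by apply: ler_sum => i _; exact: ler_norm.
have e0E : e0 = eps * (b - a) + eps by rewrite /eps; field; lra.
move: le sum_f; rewrite e0E; set S := \sum_(i < n) _; lra.
Qed.

Lemma ae_lebesgueS (R : realType) (P Q : R -> Prop) :
  (forall t, P t -> Q t) -> {ae (@lebesgue_measure R), forall t, P t} ->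
  {ae (@lebesgue_measure R), forall t, Q t}.
Proof.
by move=> PQ [A [mA A0 sub]]; exists A; split => // t nQ; apply: sub => /PQ.
Qed.

Lemma ac_id (R : realType) (a b : R) : abs_continuous_on a b id.
Proof.
move=> eps eps0; exists eps => // n u v uv _.
apply: le_lt_trans; rewrite le_eqVlt; apply/orP; left; apply/eqP.
by apply: eq_bigr => i _; rewrite ger0_norm// subr_ge0; have [_ []] := uv i.
Qed.

Lemma ac_add (R : realType) (a b : R) (f g : R -> R) :
  abs_continuous_on a b f -> abs_continuous_on a b g ->
  abs_continuous_on a b (fun t => f t + g t).
Proof.
move=> acf acg eps eps0; have eps2 : 0 < eps / 2 by rewrite divr_gt0.
have [d1 d10 acf1] := acf _ eps2; have [d2 d20 acg2] := acg _ eps2.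
exists (Order.min d1 d2); first by rewrite lt_min d10.
move=> n u v uv triv; rewrite lt_min => /andP[lt1 lt2].
have [lf lg] := (acf1 n u v uv triv lt1, acg2 n u v uv triv lt2).
rewrite [eps]splitr; apply: le_lt_trans (ltrD lf lg).
rewrite -big_split; apply: ler_sum => i _ /=.
by rewrite opprD addrACA ler_normD.
Qed.

Lemma ac_lipschitz_comp (R : realType) (a b k : R) (phi f : R -> R) :
  (forall x y, `|phi x - phi y| <= k * `|x - y|) ->
  abs_continuous_on a b f -> abs_continuous_on a b (fun t => phi (f t)).
Proof.
move=> lip acf eps eps0; have k0 : 0 < `|k| + 1 by rewrite ltr_wpDl.
have [d d0 acd] := acf (eps / (`|k| + 1)) (divr_gt0 eps0 k0).
exists d => // n u v uv triv lt; move: (acd n u v uv triv lt).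
rewrite ltr_pdivlMr// mulrC; apply: le_lt_trans.
rewrite mulr_sumr; apply: ler_sum => i _; apply: le_trans (lip _ _) _.
by rewrite ler_wpM2r// ler_wpDr// ler_norm.
Qed.

Lemma ac_scale (R : realType) (a b k : R) (f : R -> R) :
  abs_continuous_on a b f -> abs_continuous_on a b (fun t => k * f t).
Proof.
by apply: (@ac_lipschitz_comp _ _ _ `|k|) => x y; rewrite -mulrBr normrM.
Qed.

Lemma lipschitz_of_derive (R : realType) (k : R) (f df : R -> R) :
  (forall x, is_derive x (1 : R) f (df x)) -> (forall x, `|df x| <= k) ->
  forall x y, `|f x - f y| <= k * `|x - y|.
Proof.
move=> fdf dfk x y; wlog le_xy : x y / x <= y.
  have [le|/ltW le] := leP x y => [|/(_ _ _ le)]; first exact.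
  by rewrite distrC (distrC x).
have fc : {within `[x, y], continuous f}.
  apply: continuous_subspaceT => z.
  by apply: differentiable_continuous; apply/derivable1_diffP.
have [c _ E] := MVT_segment le_xy (fun z _ => fdf z) fc.
by rewrite distrC (distrC x) E normrM ler_wpM2r.
Qed.

(** Apply monotonicity to f and to - f, both corrected by the slope K. *)
Lemma ac_lipschitz_ae (R : realType) (f : R -> R) (a b K : R) :
  a <= b -> abs_continuous_on a b f ->
  {ae (@lebesgue_measure R), forall t, a <= t <= b ->
     exists2 d : R, is_derive t (1 : R) f d & `|d| <= K} ->
  `|f b - f a| <= K * (b - a).
Proof.
move=> leab acf df.
have acK k : abs_continuous_on a b (fun t : R => k * t).
  exact: ac_scale (@ac_id R a b).
have up (s : R) : `|s| = 1 -> s * f b - K * b <= s * f a - K * a.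
  move=> s1; apply: (@ac_nonincreasing _ (fun t => s * f t - K * t)) => //.
    apply: ac_add; first exact: ac_scale.
    by under eq_fun do rewrite -mulNr; exact: acK.
  apply: ae_lebesgueS df => t /= + abt => /(_ abt)[d fd dK].
  exists (s * d - K).
    have := is_deriveB (is_deriveZ s fd)
      (is_deriveZ K (is_derive_id t (1 : R))).
    by rewrite /GRing.scale/= mulr1.
  rewrite subr_le0 (le_trans (ler_norm _))// normrM s1 mul1r//.
have := up 1; rewrite normr1 => /(_ erefl) up1.
have := up (-1); rewrite normrN1 => /(_ erefl) up2.
by rewrite ler_norml; lra.
Qed.

Lemma ac_curve_constant (R : realType) (I : set R) (f : R -> R) :
  is_interval I -> abs_continuous_curve I f ->
  {ae (@lebesgue_measure R), forall t, I t -> is_derive t (1 : R) f 0} ->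
  forall s t, I s -> I t -> f s = f t.
Proof.
move=> itv acf df s t Is It; wlog st : s t Is It / s <= t.
  by move=> H; have [|/ltW] := leP s t => /H; [apply|move=> ->].
have : `|f t - f s| <= 0 * (t - s).
  apply: ac_lipschitz_ae => //; first exact: acf.
  apply: ae_lebesgueS df => r /= + srt => /(_ (itv _ _ Is It _ srt)) fr.
  by exists 0; rewrite ?normr0.
by rewrite mul0r normr_le0 subr_eq0 => /eqP.
Qed.

(** Gronwall's inequality in both time directions. The logarithm of q + f ^ 2 is
    a Lipschitz function of f for q > 0, so it is absolutely continuous and the
    a.e. bound 2 C on its derivative integrates; q then tends to 0. Regularizing
    by q is what allows f to vanish. *)
Lemma gronwall_sqr (R : realType) (f : R -> R) (a b C : R) :
  0 <= C -> a <= b -> abs_continuous_on a b f ->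
  {ae (@lebesgue_measure R), forall t, a <= t <= b ->
     exists2 d : R, is_derive t (1 : R) f d & `|d| <= C * `|f t|} ->
  f b ^+ 2 <= expR (2 * C * (b - a)) * f a ^+ 2 /\
  f a ^+ 2 <= expR (2 * C * (b - a)) * f b ^+ 2.
Proof.
move=> C0 leab acf df; set E := expR _.
have E0 : 0 < E by exact: expR_gt0.
have pos (q z : R) : 0 < q -> 0 < q + z ^+ 2.
  by move=> q0; rewrite ltr_pwDl// sqr_ge0.
have dln (q z : R) : 0 < q ->
    is_derive z (1 : R) (fun z : R => ln (q + z ^+ 2)) (2 * z / (q + z ^+ 2)).
  move=> q0; have dq : is_derive z (1 : R) (fun z : R => q + z ^+ 2) (2 * z).
    have -> : (fun z : R => q + z ^+ 2) = cst q + (id : R -> R) ^+ 2 by [].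
    by apply: is_derive_eq; rewrite /GRing.scale/= add0r expr1 mulr1.
  have := @is_derive1_comp _ (@ln R) (fun z => q + z ^+ 2) z _ _
    (is_derive1_ln (pos _ z q0)) dq.
  by rewrite mulrC.
have key q : 0 < q ->
    `|ln (q + f b ^+ 2) - ln (q + f a ^+ 2)| <= 2 * C * (b - a).
  move=> q0; apply: (@ac_lipschitz_ae _ (fun t => ln (q + f t ^+ 2))) => //.
    apply: (@ac_lipschitz_comp _ _ _ (1 + q^-1)
      (fun z => ln (q + z ^+ 2))) => //.
    apply: lipschitz_of_derive (fun z => dln q z q0) _ => z.
    rewrite normrM normfV [`|q + _|]gtr0_norm ?pos// ler_pdivrMr ?pos//.
    have -> : (1 + q^-1) * (q + z ^+ 2) = 1 + q + z ^+ 2 + z ^+ 2 / q.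
      by field; lra.
    have : 0 <= z ^+ 2 / q by rewrite divr_ge0 ?sqr_ge0// ltW.
    (* 2 |z| <= 1 + z ^ 2 *)
    set r := _ / q => r0; have := sqr_ge0 (1 - z); have := sqr_ge0 (1 + z).
    by rewrite ler_norml; nra.
  apply: ae_lebesgueS df => t /= + abt => /(_ abt)[d fd dC].
  exists (2 * f t / (q + f t ^+ 2) * d).
    exact: @is_derive1_comp _ (fun z => ln (q + z ^+ 2)) f t _ _
      (dln q (f t) q0) fd.
  rewrite !normrM normfV [`|q + _|]gtr0_norm ?pos// mulrAC ler_pdivrMr ?pos//.
  rewrite -(real_normK (num_real (f t))) (ger0_norm (ler0n _ _)).
  set m := `|f t| in dC *; have m0 : 0 <= m by exact: normr_ge0.
  have := ler_wpM2l m0 dC; have := mulr_ge0 C0 (ltW q0).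
  rewrite expr2; set D := `|d|; lra.
have exp_le q x y : 0 < q ->
    ln (q + x ^+ 2) - ln (q + y ^+ 2) <= 2 * C * (b - a) ->
    q + x ^+ 2 <= E * (q + y ^+ 2).
  move=> q0 le; rewrite -[leLHS]lnK ?posrE ?pos// -[q + y ^+ 2]lnK ?posrE ?pos//.
  by rewrite -expRD ler_expR -lerBlDr.
have lim x y : (forall q, 0 < q -> q + x ^+ 2 <= E * (q + y ^+ 2)) ->
    x ^+ 2 <= E * y ^+ 2.
  move=> le; apply/ler_addgt0Pr => e e0.
  have := le (e / E) (divr_gt0 e0 E0); rewrite mulrDr mulrCA divff ?gt_eqF//.
  have := divr_gt0 e0 E0; lra.
split; apply: lim => q q0; apply: exp_le => //.
  by have := key q q0; rewrite ler_norml; lra.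
by have := key q q0; rewrite ler_norml; lra.
Qed.

Lemma locally_bounded_segment (R : realType) (I : set R) (h : R -> R)
    (a b : R) :
  `[a, b]%classic `<=` I -> [locally [bounded h t | t in I]] ->
  exists B : R, forall t, a <= t <= b -> `|h t| <= B.
Proof.
move=> abI lb.
have /compact_near_coveringP/near_covering_withinP := @segment_compact R a b.
move=> /(_ R (nbhs +oo) (fun M t => `|h t| <= M)) H.
have {}H : \forall M \near +oo, `[a, b]%classic `<=` [set t | `|h t| <= M].
  apply: H => x abx.
  have [M M0 HM] := ex_strict_bound_gt0 (lb x (abI x abx)).
  exists ([set t | I t -> `|h t| < M], [set N | M < N]) => /=.
    by split; [exact: HM|exact: nbhs_pinfty_gt (num_real M)].
  by move=> [t N] [/= HtM MN] abt; apply/ltW/(lt_trans (HtM (abI t abt))).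
have [B HB] := filter_ex H.
by exists B => t abt; apply: HB; rewrite /= in_itv.
Qed.

(** * The equations of motion in scalar form *)

Definition col4 (R : realType) (a b c d : R) : 'cV[R]_(2 + 2) :=
  mx_of_rows 4 1 [:: [:: a]; [:: b]; [:: c]; [:: d]].

(** The four rows of the system once the frame rotations are undone: the first
    two say that the total force vanishes, the last two balance the torques
    about the joint, on the whole swimmer and on the second link. The
    velocity (u, v) of the centre of the second link is expressed in the frame
    of that link, the forces in the frame of the first one. *)
Definition balance (R : realType) (l1 l2 xi1 xi2 eta1 eta2 : R)
    (alpha u v dth dal r3 r4 : R) : Prop :=
  [/\ - (xi1 * l1 + xi2 * l2) * cos alpha * u
        - (xi1 * l1 + eta2 * l2) * sin alpha * v
        + 2^-1 * xi1 * l1 * l2 * sin alpha * dth = 0,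
      (eta1 * l1 + xi2 * l2) * sin alpha * u
        - (eta1 * l1 + eta2 * l2) * cos alpha * v
        + 2^-1 * eta1 * l1 * (l1 + l2 * cos alpha) * dth
        + 2^-1 * eta1 * l1 ^+ 2 * dal = 0,
      - (2^-1 * eta1 * l1 ^+ 2 * sin alpha) * u
        + 2^-1 * (eta1 * l1 ^+ 2 * cos alpha - eta2 * l2 ^+ 2) * v
        + (- (eta1 * l1 ^+ 2) * (4^-1 * l2 * cos alpha + 3^-1 * l1)
           - 12^-1 * eta2 * l2 ^+ 3) * dth
        - 3^-1 * eta1 * l1 ^+ 3 * dal = r3 &
      - (2^-1 * eta2 * l2 ^+ 2) * v - 12^-1 * eta2 * l2 ^+ 3 * dth = r4].

Lemma col4_inj (R : realType) (a b c d a' b' c' d' : R) :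
  col4 a b c d = col4 a' b' c' d' -> [/\ a = a', b = b', c = c' & d = d'].
Proof.
move=> /colP E; split.
- by have := E (@Ordinal 4 0 isT); rewrite !mxE.
- by have := E (@Ordinal 4 1 isT); rewrite !mxE.
- by have := E (@Ordinal 4 2 isT); rewrite !mxE.
- by have := E (@Ordinal 4 3 isT); rewrite !mxE.
Qed.

Lemma block_rot_col4 (R : realType) (phi a b c d : R) :
  block_mx (Defs.rot phi) 0 0 1%:M *m col4 a b c d =
  col4 (cos phi * a - sin phi * b) (sin phi * a + cos phi * b) c d.
Proof.
have colE x y z t : col4 x y z t =
    col_mx (mx_of_rows 2 1 [:: [:: x]; [:: y]])
           (mx_of_rows 2 1 [:: [:: z]; [:: t]]) :> 'cV[R]_(2 + 2).
  apply/colP => i; rewrite !mxE.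
  by case: splitP => j /= ->; rewrite !mxE; case: j => [[|[|]]].
rewrite !colE mul_block_col !mul0mx mul1mx addr0 add0r; congr col_mx.
apply/colP => i; rewrite !mxE !big_ord_recl big_ord0 !mxE /=.
by case: i => [[|[|]]] //= _; ring.
Qed.

Lemma rotation_eq0 (R : realType) (phi p q : R) :
  cos phi * p - sin phi * q = 0 -> sin phi * p + cos phi * q = 0 ->
  p = 0 /\ q = 0.
Proof.
move=> E1 E2; have cs := cos2Dsin2 phi; split.
- rewrite -[p]mul1r -cs.
  transitivity (cos phi * (cos phi * p - sin phi * q) +
      sin phi * (sin phi * p + cos phi * q)); first by ring.
  by rewrite E1 E2 !mulr0 addr0.
- rewrite -[q]mul1r -cs.
  transitivity (cos phi * (sin phi * p + cos phi * q)
      - sin phi * (cos phi * p - sin phi * q)); first by ring.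
  by rewrite E1 E2 !mulr0 subr0.
Qed.

Lemma swimmer_balance (R : realType)
    (l1 l2 xi1 xi2 eta1 eta2 kappa M1 M2 : R)
    (theta alpha hpar hperp dx dy dth dal : R) :
  Mh l1 l2 xi1 xi2 eta1 eta2 theta alpha
    *m mx_of_rows 4 1 [:: [:: dx]; [:: dy]; [:: dth]; [:: dal]]
    = swimmer_rhs kappa M1 M2 alpha hpar hperp ->
  balance l1 l2 xi1 xi2 eta1 eta2 alpha
    (cos theta * dx + sin theta * dy) (cos theta * dy - sin theta * dx) dth dal
    (- M1 * (cos alpha * hperp - sin alpha * hpar) - M2 * hperp)
    (- kappa * alpha - M2 * hperp).
Proof.
move=> E; set u := _ * dx + _; set v := _ * dy - _.
rewrite /Mh -/(col4 dx dy dth dal) -!mulmxA block_rot_col4 cosN sinN in E.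
set w := col4 _ _ _ _ in E.
have Ew : Emx l1 l2 xi1 xi2 eta1 eta2 alpha *m w = col4
   (- (xi1 * l1 + xi2 * l2) * cos alpha * u
        - (xi1 * l1 + eta2 * l2) * sin alpha * v
        + 2^-1 * xi1 * l1 * l2 * sin alpha * dth)
   ((eta1 * l1 + xi2 * l2) * sin alpha * u
        - (eta1 * l1 + eta2 * l2) * cos alpha * v
        + 2^-1 * eta1 * l1 * (l1 + l2 * cos alpha) * dth
        + 2^-1 * eta1 * l1 ^+ 2 * dal)
   (- (2^-1 * eta1 * l1 ^+ 2 * sin alpha) * u
        + 2^-1 * (eta1 * l1 ^+ 2 * cos alpha - eta2 * l2 ^+ 2) * v
        + (- (eta1 * l1 ^+ 2) * (4^-1 * l2 * cos alpha + 3^-1 * l1)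
           - 12^-1 * eta2 * l2 ^+ 3) * dth
        - 3^-1 * eta1 * l1 ^+ 3 * dal)
   (- (2^-1 * eta2 * l2 ^+ 2) * v - 12^-1 * eta2 * l2 ^+ 3 * dth).
  apply/colP => i; rewrite /w /col4 !mxE !big_ord_recl big_ord0 !mxE /= /u /v.
  by case: i => [[|[|[|[|]]]]] //= _; ring.
rewrite Ew block_rot_col4 /swimmer_rhs -/(col4 _ _ _ _) in E.
case: (col4_inj E) => F1 F2 E3 E4.
by have [E1 E2] := rotation_eq0 F1 F2; split.
Qed.

Lemma is_derive_derive1 (R : realType) (f : R -> R) (t : R) :
  derivable f t 1 -> is_derive t (1 : R) f (derive1 f t).
Proof. by move=> ft; rewrite derive1E; exact: derivableP. Qed.

Lemma swimmer_velocities (R : realType)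
    (l1 l2 xi1 xi2 eta1 eta2 kappa M1 M2 : R) (I : set R)
    (Hpar Hperp x y theta alpha : R -> R) :
  swimmer_solution l1 l2 xi1 xi2 eta1 eta2 kappa M1 M2
    I Hpar Hperp x y theta alpha ->
  {ae (@lebesgue_measure R), forall t, I t -> exists dx dy dth dal : R,
     [/\ is_derive t (1 : R) x dx, is_derive t (1 : R) y dy,
         is_derive t (1 : R) theta dth, is_derive t (1 : R) alpha dal &
         balance l1 l2 xi1 xi2 eta1 eta2 (alpha t)
           (cos (theta t) * dx + sin (theta t) * dy)
           (cos (theta t) * dy - sin (theta t) * dx) dth dal
           (- M1 * (cos (alpha t) * Hperp t - sin (alpha t) * Hpar t)
            - M2 * Hperp t)
           (- kappa * alpha t - M2 * Hperp t)]}.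
Proof.
move=> [_ _ _ _ ae]; apply: ae_lebesgueS ae => t /= H /H[xP yP thP alP E].
exists (derive1 x t), (derive1 y t), (derive1 theta t), (derive1 alpha t).
split; last exact: swimmer_balance E.
- exact: is_derive_derive1 xP.
- exact: is_derive_derive1 yP.
- exact: is_derive_derive1 thP.
- exact: is_derive_derive1 alP.
Qed.

(** * Isotropic drag *)

(** With equal drag coefficients the force on a link only sees the velocity of
    its midpoint, so the zero total force says that the drag-weighted mean of
    the two midpoint velocities vanishes. *)
Lemma isotropic_velocity (R : realType)
    (l1 l2 eta1 eta2 theta alpha dx dy dth dal r3 r4 : R) :
  balance l1 l2 eta1 eta2 eta1 eta2 alpha
    (cos theta * dx + sin theta * dy) (cos theta * dy - sin theta * dx)
    dth dal r3 r4 ->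
  (eta1 * l1 + eta2 * l2) * dx =
    - (2^-1 * eta1 * l1 * (l1 * sin (alpha + theta) * (dal + dth)
                           + l2 * sin theta * dth)) /\
  (eta1 * l1 + eta2 * l2) * dy =
    2^-1 * eta1 * l1 * (l1 * cos (alpha + theta) * (dal + dth)
                        + l2 * cos theta * dth).
Proof.
set u := cos theta * dx + _; set v := cos theta * dy - _; move=> [E1 E2 _ _].
have csa := cos2Dsin2 alpha; have cst := cos2Dsin2 theta.
set D := eta1 * l1 + eta2 * l2 in E1 E2 *.
set k := 2^-1 * eta1 * l1 in E1 E2 *.
set ca := cos alpha in E1 E2 csa *; set sa := sin alpha in E1 E2 csa *.
have Du : D * u = - (k * l1 * sa * (dal + dth)).
  have := congr1 (GRing.mul ca) E1; have := congr1 (GRing.mul sa) E2.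
  by have := congr1 (GRing.mul (D * u)) csa; rewrite !mulr0 mulr1 /k; lra.
have Dv : D * v = k * l2 * dth + k * l1 * ca * (dal + dth).
  have := congr1 (GRing.mul sa) E1; have := congr1 (GRing.mul ca) E2.
  have := congr1 (GRing.mul (k * l2 * dth)) csa.
  by have := congr1 (GRing.mul (D * v)) csa; rewrite !mulr0 !mulr1 /k; lra.
have xE : dx = cos theta * u - sin theta * v.
  by rewrite -[LHS]mul1r -cst /u /v; ring.
have yE : dy = sin theta * u + cos theta * v.
  by rewrite -[LHS]mul1r -cst /u /v; ring.
rewrite {1}xE {1}yE sinD cosD -/ca -/sa; split.
- transitivity (cos theta * (D * u) - sin theta * (D * v)); first by ring.
  by rewrite Du Dv; ring.
- transitivity (sin theta * (D * u) + cos theta * (D * v)); first by ring.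
  by rewrite Du Dv; ring.
Qed.

(** Both coordinates are covered: phi is the cosine for one and the sine for
    the other. *)
Lemma link_offset_constant (R : realType) (I : set R) (K l1 l2 : R)
    (phi dphi z theta alpha : R -> R) :
  (forall s, is_derive s (1 : R) phi (dphi s)) -> (forall s, `|dphi s| <= 1) ->
  is_interval I -> abs_continuous_curve I z ->
  abs_continuous_curve I theta -> abs_continuous_curve I alpha ->
  {ae (@lebesgue_measure R), forall t, I t -> exists dz dth dal : R,
     [/\ is_derive t (1 : R) z dz, is_derive t (1 : R) theta dth,
         is_derive t (1 : R) alpha dal &
         dz = K * (l1 * (dphi (alpha t + theta t) * (dal + dth))
                   + l2 * (dphi (theta t) * dth))]} ->
  forall s t, I s -> I t ->
    z s - K * (l1 * phi (alpha s + theta s) + l2 * phi (theta s)) =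
    z t - K * (l1 * phi (alpha t + theta t) + l2 * phi (theta t)).
Proof.
move=> dphiP dphi1 itv acz acth acal dE.
have lip := lipschitz_of_derive dphiP dphi1.
pose G t := l1 * phi (alpha t + theta t) + l2 * phi (theta t).
apply: (@ac_curve_constant _ _ (fun t => z t - K * G t)) => //.
  move=> a b Ia Ib ab; apply: ac_add; first exact: acz.
  have -> : (fun t => - (K * G t)) = (fun t => - K * G t).
    by apply/funext => t; rewrite mulNr.
  apply/ac_scale/ac_add; apply/ac_scale/(ac_lipschitz_comp lip).
    by apply: ac_add; [exact: acal|exact: acth].
  exact: acth.
apply: ae_lebesgueS dE => t /= H /H[dz [dth [dal [zP thP alP dzE]]]].
have P1 : is_derive t (1 : R) (phi \o (alpha + theta))
    (dphi (alpha t + theta t) * (dal + dth)).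
  exact: @is_derive1_comp _ phi (alpha + theta) t _ _ (dphiP _)
    (is_deriveD alP thP).
have P2 : is_derive t (1 : R) (phi \o theta) (dphi (theta t) * dth).
  exact: @is_derive1_comp _ phi theta t _ _ (dphiP _) thP.
have := is_deriveB zP
  (is_deriveZ K (is_deriveD (is_deriveZ l1 P1) (is_deriveZ l2 P2))).
by rewrite dzE /GRing.scale/= subrr.
Qed.

Lemma isotropic_position (R : realType)
    (l1 l2 eta1 eta2 kappa M1 M2 : R) (I : set R)
    (Hpar Hperp x y theta alpha : R -> R) :
  eta1 * l1 + eta2 * l2 != 0 ->
  swimmer_solution l1 l2 eta1 eta2 eta1 eta2 kappa M1 M2
    I Hpar Hperp x y theta alpha ->
  let K := eta1 * l1 / (2 * (eta1 * l1 + eta2 * l2)) in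
  forall s t, I s -> I t ->
    x s - K * (l1 * cos (alpha s + theta s) + l2 * cos (theta s)) =
    x t - K * (l1 * cos (alpha t + theta t) + l2 * cos (theta t)) /\
    y s - K * (l1 * sin (alpha s + theta s) + l2 * sin (theta s)) =
    y t - K * (l1 * sin (alpha t + theta t) + l2 * sin (theta t)).
Proof.
move=> D0 sol K s t Is It; have vel := swimmer_velocities sol.
have [[itv _] _ [acx acy acth acal] _ _] := sol.
have sin_bound r : `|- sin r| <= 1 :> R by rewrite normrN sin_max.
split.
- apply: (link_offset_constant (@is_derive_cos R) sin_bound itv acx acth acal _
    Is It).
  apply: ae_lebesgueS vel => r H /H[dx [dy [dth [dal [xP _ thP alP E]]]]].
  exists dx, dth, dal; split => //.
  have [Dx _] := isotropic_velocity E.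
  by apply: (mulfI D0); rewrite Dx /K; field.
- apply: (link_offset_constant (@is_derive_sin R) (@cos_max R) itv acy acth acal
    _ Is It).
  apply: ae_lebesgueS vel => r H /H[dx [dy [dth [dal [_ yP thP alP E]]]]].
  exists dy, dth, dal; split => //.
  have [_ Dy] := isotropic_velocity E.
  by apply: (mulfI D0); rewrite Dy /K; field.
Qed.

(** The two angles are only prescribed modulo 2 pi, which their cosine and
    sine do not see. *)
Lemma cos_sin_same_angle (R : realType) (a b : R) :
  same_angle a b -> cos a = cos b /\ sin a = sin b.
Proof.
move=> [k ->]; have shift (n : nat) (x : R) :
    cos (x + n%:R * (2 * pi)) = cos x /\ sin (x + n%:R * (2 * pi)) = sin x.
  rewrite !mulr_natl.
  by split; apply: periodicn; [exact: cosD2pi|exact: sinD2pi].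
case: k => n; first exact: shift.
have [<- <-] := shift n.+1 (b + (Negz n)%:~R * (2 * pi)).
by rewrite NegzE mulrNz mulNr addrNK.
Qed.

(** * Invariance of the straight shape *)

(** A quadratic form that dominates k times the Euclidean one and is bounded by
    a linear form of size r forces its argument to be of size r / k; the factor
    4 is the number of variables. *)
Lemma quadratic_energy_bound (R : realFieldType) (k r u v w z : R) :
  0 < k -> 0 <= r ->
  k * (u ^+ 2 + v ^+ 2 + w ^+ 2 + z ^+ 2) <= r * (`|w| + `|z|) ->
  `|u| + `|v| + `|w| + `|z| <= 4 * r / k.
Proof.
move=> k0 r0.
rewrite -(real_normK (num_real u)) -(real_normK (num_real v)).
rewrite -(real_normK (num_real w)) -(real_normK (num_real z)).
have [] := (normr_ge0 u, normr_ge0 v); have [] := (normr_ge0 w, normr_ge0 z).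
set a := `|u|; set b := `|v|; set c := `|w|; set d := `|z| => c0 d0 a0 b0 le.
rewrite ler_pdivlMr//; set m := a + b + c + d.
have m0 : 0 <= m by rewrite /m; lra.
have sq : m ^+ 2 <= 4 * (a ^+ 2 + b ^+ 2 + c ^+ 2 + d ^+ 2).
  have := sqr_ge0 (a - b); have := sqr_ge0 (a - c); have := sqr_ge0 (a - d).
  have := sqr_ge0 (b - c); have := sqr_ge0 (b - d); have := sqr_ge0 (c - d).
  rewrite /m !expr2; lra.
have : m * (m * k) <= m * (4 * r).
  apply: (@le_trans _ _ (4 * (r * (c + d)))).
    apply: (@le_trans _ _ (4 * (k * (a ^+ 2 + b ^+ 2 + c ^+ 2 + d ^+ 2)))).
      have := ler_wpM2l (ltW k0) sq; rewrite !expr2; lra.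
    by lra.
  have := mulr_ge0 r0 (addr_ge0 a0 b0); rewrite /m; lra.
have [->|mn0] := eqVneq m 0; first by rewrite mul0r; lra.
by rewrite ler_pM2l// lt_neqAle eq_sym mn0.
Qed.

(** Quantitative invertibility of the resistance matrix, uniform in the angle:
    the power Phi dissipated by the drag is a positive definite quadratic form
    in the velocities, and it equals the power of the applied torques, which
    is linear in the angular velocities. *)
Lemma velocity_bound (R : realType) (l1 l2 xi1 xi2 eta1 eta2 : R) :
  0 < l1 -> 0 < l2 -> 0 < xi1 -> 0 < xi2 -> 0 < eta1 -> 0 < eta2 ->
  exists2 C : R, 0 <= C & forall alpha u v dth dal r3 r4 : R,
    balance l1 l2 xi1 xi2 eta1 eta2 alpha u v dth dal r3 r4 ->
    `|u| + `|v| + `|dth| <= C * (`|r3| + `|r4|).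
Proof.
move=> l10 l20 xi10 xi20 eta10 eta20.
pose k := Order.min (Order.min (xi2 * l2) (eta2 * l2))
  (Order.min (12^-1 * eta2 * l2 ^+ 3) (12^-1 * eta1 * l1 ^+ 3)).
have k0 : 0 < k by rewrite !lt_min !mulr_gt0// ?exprn_gt0.
exists (8 / k); first by rewrite divr_ge0// ltW.
move=> alpha u v dth dal r3 r4 [E1 E2 E3 E4].
have cs := cos2Dsin2 alpha.
set c := cos alpha in E1 E2 E3 cs; set s := sin alpha in E1 E2 E3 cs.
(* w is the angular velocity of the first link, (u, V) the velocity of the
   joint in the frame of the second link and (U1, W1) in that of the first. *)
pose w := dth + dal; pose V := v - 2^-1 * l2 * dth.
pose U1 := c * u + s * V; pose W1 := - s * u + c * V.
pose Phi := xi1 * l1 * U1 ^+ 2 + eta1 * l1 * (W1 - 2^-1 * l1 * w) ^+ 2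
  + 12^-1 * eta1 * l1 ^+ 3 * w ^+ 2 + xi2 * l2 * u ^+ 2 + eta2 * l2 * v ^+ 2
  + 12^-1 * eta2 * l2 ^+ 3 * dth ^+ 2.
have PhiE : Phi = - (r3 - r4) * w - r4 * dth.
  transitivity (Phi + (c ^+ 2 + s ^+ 2 - 1)
                      * (xi2 * l2 * u ^+ 2 + eta2 * l2 * v * V)).
    by rewrite cs subrr mul0r addr0.
  have := congr1 (fun z => z * U1) E1; have := congr1 (fun z => z * W1) E2.
  by rewrite !mul0r -E3 -E4 /Phi /U1 /W1 /V /w; lra.
have Phi_ge : k * (u ^+ 2 + v ^+ 2 + dth ^+ 2 + w ^+ 2) <= Phi.
  have kle : [/\ k <= xi2 * l2, k <= eta2 * l2, k <= 12^-1 * eta2 * l2 ^+ 3 &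
      k <= 12^-1 * eta1 * l1 ^+ 3].
    by rewrite /k; split; rewrite !ge_min lexx ?orbT.
  case: kle => k1 k2 k3 k4.
  have := ler_wpM2r (sqr_ge0 u) k1; have := ler_wpM2r (sqr_ge0 v) k2.
  have := ler_wpM2r (sqr_ge0 dth) k3; have := ler_wpM2r (sqr_ge0 w) k4.
  have := mulr_ge0 (ltW (mulr_gt0 xi10 l10)) (sqr_ge0 U1).
  have := mulr_ge0 (ltW (mulr_gt0 eta10 l10)) (sqr_ge0 (W1 - 2^-1 * l1 * w)).
  rewrite /Phi; lra.
set r := `|r3| + `|r4|; have r0 : 0 <= r by rewrite addr_ge0.
have Phi_le : Phi <= 2 * r * (`|dth| + `|w|).
  rewrite PhiE (le_trans (ler_norm _))// (le_trans (ler_normB _ _))//.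
  rewrite !normrM normrN.
  have n1 : `|r3 - r4| <= r by exact: ler_normB.
  have n2 : `|r4| <= r by rewrite /r lerDr.
  have := ler_wpM2r (normr_ge0 w) n1; have := ler_wpM2r (normr_ge0 dth) n2.
  have := mulr_ge0 r0 (normr_ge0 w); have := mulr_ge0 r0 (normr_ge0 dth); lra.
have := quadratic_energy_bound k0 (mulr_ge0 (ler0n R 2) r0)
  (le_trans Phi_ge Phi_le).
have -> : 4 * (2 * r) / k = 8 / k * r by ring.
by have := normr_ge0 w; lra.
Qed.

(** The rate of the shape angle is isolated by a combination of the last three
    rows whose coefficients p2, p3, p4 eliminate all other velocities when the
    swimmer is straight. Away from the straight shape the remaining terms carry
    a factor sin alpha or 1 - cos alpha, or alpha itself from the elastic
    torque; the hypothesis on M1 and M2 says exactly that the magnetic torques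
    cancel in this combination at alpha = 0. *)
Lemma shape_rate (R : realType) (l1 l2 xi1 xi2 eta1 eta2 kappa M1 M2 : R) :
  0 < l1 -> 0 < l2 -> 0 < eta1 -> 0 < eta2 ->
  (3 + 4 * (l2 / l1) + (eta2 * l2 ^+ 2) / (eta1 * l1 ^+ 2)) * M1
   - (3 + 4 * (l1 / l2) + (eta1 * l1 ^+ 2) / (eta2 * l2 ^+ 2)) * M2 = 0 ->
  exists2 delta : R, 0 < delta & exists A1 A2 A3 A4 A5 : R,
  forall alpha u v dth dal hpar hperp : R,
    balance l1 l2 xi1 xi2 eta1 eta2 alpha u v dth dal
      (- M1 * (cos alpha * hperp - sin alpha * hpar) - M2 * hperp)
      (- kappa * alpha - M2 * hperp) ->
    delta * dal = A1 * (sin alpha * u) + A2 * ((1 - cos alpha) * v)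
      + A3 * ((1 - cos alpha) * dth)
      + A4 * ((1 - cos alpha) * hperp + sin alpha * hpar) + A5 * alpha.
Proof.
move=> l10 l20 eta10 eta20 hM.
pose a := eta1 * l1; pose b := eta2 * l2.
have a0 : 0 < a by rewrite mulr_gt0.
have b0 : 0 < b by rewrite mulr_gt0.
(* (p2, p3, p4) spans the left kernel of the columns of v and dth in the rows
   2 to 4 of the matrix at alpha = 0; p34 is the sum of p3 and p4, the
   coefficient of M2 in the combined magnetic torque, and - delta is what the
   combination leaves in the column of the shape rate. *)
pose p2 := 2 * a * b * l1 * l2 * (l1 + l2).
pose p3 := b * l2 * (3 * a * l1 + 4 * a * l2 + b * l2).
pose p34 := - (a * l1 * (a * l1 + 3 * b * l2 + 4 * b * l1)).
pose p4 := p34 - p3.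
pose delta := 3^-1 * a * b * l1 ^+ 2 * l2 ^+ 2 * (a + b).
exists delta; first by rewrite !mulr_gt0 ?exprn_gt0 ?addr_gt0.
have pM : p3 * M1 + p34 * M2 = 0.
  rewrite -[RHS](mulr0 (a * b * l1 * l2)) -hM /p3 /p34 /a /b.
  by field; rewrite !gt_eqF.
pose A1 := p2 * (a + xi2 * l2) - 2^-1 * p3 * a * l1.
pose A2 := p2 * (a + b) - 2^-1 * p3 * a * l1.
pose A3 := - (2^-1 * p2 * a * l2) + 4^-1 * p3 * a * l1 * l2.
exists A1, A2, A3, (- (p3 * M1)), (p4 * kappa).
move=> alpha u v dth dal hpar hperp [_ E2 E3 E4].
have := congr1 (GRing.mul p2) E2; have := congr1 (GRing.mul p3) E3.
have := congr1 (GRing.mul p4) E4; have := congr1 (GRing.mul hperp) pM.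
by rewrite /A1 /A2 /A3 /delta /p4 /p34 /p3 /p2 /a /b; lra.
Qed.

Lemma sin_norm_le (R : realType) (x : R) : `|sin x| <= `|x|.
Proof.
have := lipschitz_of_derive (fun x => is_derive_sin x) (@cos_max R) x 0.
by rewrite sin0 !subr0 mul1r.
Qed.

Lemma one_minus_cos_norm_le (R : realType) (x : R) : `|1 - cos x| <= `|x|.
Proof.
have sin_le z : `|- sin z| <= 1 :> R by rewrite normrN sin_max.
have := lipschitz_of_derive (fun x => is_derive_cos x) sin_le x 0.
by rewrite cos0 subr0 mul1r distrC.
Qed.

(** The torques, hence the velocities, grow with alpha itself through the
    elastic term, so a factor g = sin alpha or 1 - cos alpha has to be used
    both as small as alpha and as bounded. *)
Lemma norm_mul_affine_le (R : realFieldType) (g q z X k : R) :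
  0 <= X -> 0 <= k -> `|g| <= `|z| -> `|g| <= 2 -> `|q| <= X + k * `|z| ->
  `|g * q| <= (X + 2 * k) * `|z|.
Proof.
move=> X0 k0 g_le g2 q_le; rewrite normrM.
apply: le_trans (ler_wpM2l (normr_ge0 g) q_le) _.
have := ler_wpM2r X0 g_le.
have := ler_wpM2r (mulr_ge0 k0 (normr_ge0 z)) g2; lra.
Qed.

Lemma torque_bound (R : realType) (kappa M1 M2 B alpha hpar hperp : R) :
  0 <= kappa -> `|hpar| <= B -> `|hperp| <= B ->
  `|- M1 * (cos alpha * hperp - sin alpha * hpar) - M2 * hperp|
    + `|- kappa * alpha - M2 * hperp|
  <= 2 * (`|M1| + `|M2|) * B + kappa * `|alpha|.
Proof.
move=> kappa0 hparB hperpB.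
have mulB (m g h : R) : `|g| <= 1 -> `|h| <= B -> `|m * (g * h)| <= `|m| * B.
  move=> g1 hB; rewrite !normrM ler_wpM2l//.
  by rewrite (le_trans (ler_pM _ _ g1 hB))// mul1r.
have n1 := mulB M1 _ _ (cos_max alpha) hperpB.
have n2 := mulB M1 _ _ (sin_max alpha) hparB.
have n3 : `|M2 * hperp| <= `|M2| * B by rewrite normrM ler_wpM2l.
have n4 : `|- kappa * alpha| = kappa * `|alpha|.
  by rewrite normrM normrN (ger0_norm kappa0).
have := ler_normB (- kappa * alpha) (M2 * hperp).
have := ler_normB (M1 * (sin alpha * hpar)) (M1 * (cos alpha * hperp)).
have := ler_normB (M1 * (sin alpha * hpar) - M1 * (cos alpha * hperp))
  (M2 * hperp).
have -> : M1 * (sin alpha * hpar) - M1 * (cos alpha * hperp) =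
  - M1 * (cos alpha * hperp - sin alpha * hpar) by ring.
lra.
Qed.

(** The estimate that makes the straight shape invariant: under bounded
    controls the rate of the shape angle is at most linear in that angle. *)
Lemma shape_rate_bound (R : realType)
    (l1 l2 xi1 xi2 eta1 eta2 kappa M1 M2 B : R) :
  0 < l1 -> 0 < l2 -> 0 < xi1 -> 0 < xi2 -> 0 < eta1 -> 0 < eta2 ->
  0 <= kappa -> 0 <= B ->
  (3 + 4 * (l2 / l1) + (eta2 * l2 ^+ 2) / (eta1 * l1 ^+ 2)) * M1
   - (3 + 4 * (l1 / l2) + (eta1 * l1 ^+ 2) / (eta2 * l2 ^+ 2)) * M2 = 0 ->
  exists2 C : R, 0 <= C & forall alpha u v dth dal hpar hperp : R,
    `|hpar| <= B -> `|hperp| <= B ->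
    balance l1 l2 xi1 xi2 eta1 eta2 alpha u v dth dal
      (- M1 * (cos alpha * hperp - sin alpha * hpar) - M2 * hperp)
      (- kappa * alpha - M2 * hperp) ->
    `|dal| <= C * `|alpha|.
Proof.
move=> l10 l20 xi10 xi20 eta10 eta20 kappa0 B0 hM.
have [C0 C00 vb] := velocity_bound l10 l20 xi10 xi20 eta10 eta20.
have [delta delta0 [A1 [A2 [A3 [A4 [A5 rateE]]]]]] :=
  shape_rate xi1 xi2 kappa l10 l20 eta10 eta20 hM.
pose X := C0 * (2 * (`|M1| + `|M2|) * B).
have X0 : 0 <= X by rewrite !mulr_ge0// addr_ge0.
pose k := C0 * kappa; have k0 : 0 <= k by rewrite mulr_ge0.
pose S := X + 2 * k; have S0 : 0 <= S by rewrite /S; lra.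
exists ((`|A1| * S + `|A2| * S + `|A3| * S + `|A4| * (2 * B) + `|A5|) / delta).
  by rewrite divr_ge0 ?(ltW delta0)// !addr_ge0// ?mulr_ge0// mulr_ge0.
move=> alpha u v dth dal hpar hperp hparB hperpB E.
have vel_le : `|u| + `|v| + `|dth| <= X + k * `|alpha|.
  apply: le_trans (vb _ _ _ _ _ _ _ E) _.
  have -> : X + k * `|alpha| =
    C0 * (2 * (`|M1| + `|M2|) * B + kappa * `|alpha|) by rewrite /X /k; ring.
  by rewrite ler_wpM2l//; exact: torque_bound.
have {rateE E} dalE := rateE _ _ _ _ _ _ _ E.
have s_le := sin_norm_le alpha; have c_le := one_minus_cos_norm_le alpha.
have s2 : `|sin alpha| <= 2 by rewrite (le_trans (sin_max _))// ler1n.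
have c2 : `|1 - cos alpha| <= 2.
  rewrite (le_trans (ler_normB _ _))// normr1.
  by have := cos_max alpha; clear; lra.
have [u_le v_le w_le] : [/\ `|u| <= X + k * `|alpha|,
    `|v| <= X + k * `|alpha| & `|dth| <= X + k * `|alpha|].
  have [nu nv] := (normr_ge0 u, normr_ge0 v); have nw := normr_ge0 dth.
  clear - vel_le nu nv nw; split; lra.
have su := norm_mul_affine_le X0 k0 s_le s2 u_le.
have cv := norm_mul_affine_le X0 k0 c_le c2 v_le.
have cw := norm_mul_affine_le X0 k0 c_le c2 w_le.
have ch : `|(1 - cos alpha) * hperp + sin alpha * hpar| <= 2 * B * `|alpha|.
  rewrite (le_trans (ler_normD _ _))// !normrM.
  have := ler_pM (normr_ge0 _) (normr_ge0 _) c_le hperpB.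
  have := ler_pM (normr_ge0 _) (normr_ge0 _) s_le hparB.
  clear; lra.
rewrite mulrAC ler_pdivlMr// mulrC -{1}(gtr0_norm delta0) -normrM dalE.
rewrite [leRHS](_ : _ = `|A1| * (S * `|alpha|) + `|A2| * (S * `|alpha|)
  + `|A3| * (S * `|alpha|) + `|A4| * (2 * B * `|alpha|) + `|A5| * `|alpha|);
  last by ring.
do 4?[apply: le_trans (ler_normD _ _) _; apply: lerD].
all: by rewrite normrM ler_wpM2l.
Qed.

Lemma straight_invariant (R : realType)
    (l1 l2 xi1 xi2 eta1 eta2 kappa M1 M2 : R) (I : set R)
    (Hpar Hperp x y theta alpha : R -> R) :
  0 < l1 -> 0 < l2 -> 0 < xi1 -> 0 < xi2 -> 0 < eta1 -> 0 < eta2 ->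
  0 <= kappa ->
  (3 + 4 * (l2 / l1) + (eta2 * l2 ^+ 2) / (eta1 * l1 ^+ 2)) * M1
   - (3 + 4 * (l1 / l2) + (eta1 * l1 ^+ 2) / (eta2 * l2 ^+ 2)) * M2 = 0 ->
  swimmer_solution l1 l2 xi1 xi2 eta1 eta2 kappa M1 M2
    I Hpar Hperp x y theta alpha ->
  forall s t, I s -> I t -> alpha s = 0 -> alpha t = 0.
Proof.
move=> l10 l20 xi10 xi20 eta10 eta20 kappa0 hM sol.
have vel := swimmer_velocities sol.
have [[itv _] [[_ bpar] [_ bperp]] [_ _ _ acal] _ _] := sol.
have bound a b : I a -> I b -> a <= b -> exists E,
    alpha b ^+ 2 <= E * alpha a ^+ 2 /\ alpha a ^+ 2 <= E * alpha b ^+ 2.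
  move=> Ia Ib ab.
  have abI : `[a, b]%classic `<=` I.
    by move=> r /=; rewrite in_itv/= => abr; exact: itv Ia Ib _ abr.
  have [B1 HB1] := locally_bounded_segment abI bpar.
  have [B2 HB2] := locally_bounded_segment abI bperp.
  pose B := `|B1| + `|B2|; have B0 : 0 <= B by rewrite addr_ge0.
  have [C C0 HC] :=
    shape_rate_bound l10 l20 xi10 xi20 eta10 eta20 kappa0 B0 hM.
  exists (expR (2 * C * (b - a))); apply: gronwall_sqr => //; first exact: acal.
  apply: ae_lebesgueS vel => r H abr.
  have [dx [dy [dth [dal [_ _ _ alP E]]]]] := H (itv _ _ Ia Ib _ abr).
  exists dal => //; apply: HC E.
  - by rewrite (le_trans (HB1 r abr))// (le_trans (ler_norm _))// lerDl.
  - by rewrite (le_trans (HB2 r abr))// (le_trans (ler_norm _))// lerDr.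
move=> s t Is It als0.
have [E le_t] : exists E, alpha t ^+ 2 <= E * alpha s ^+ 2.
  by have [st|/ltW ts] := leP s t;
    [have [E []] := bound _ _ Is It st|have [E []] := bound _ _ It Is ts];
    exists E.
move: le_t; rewrite als0 expr0n mulr0 => le_t.
by apply/eqP; rewrite -sqrf_eq0 eq_le le_t sqr_ge0.
Qed.

(** * Conclusion for the swimmer *)

Unset Implicit Arguments.

Theorem proposition3p1 (R : realType)
    (l1 l2 xi1 xi2 eta1 eta2 kappa M1 M2 : R)
    (l1_gt0 : 0 < l1) (l2_gt0 : 0 < l2)
    (xi1_gt0 : 0 < xi1) (xi2_gt0 : 0 < xi2)
    (eta1_gt0 : 0 < eta1) (eta2_gt0 : 0 < eta2)
    (kappa_gt0 : 0 < kappa) :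
  (eta1 - xi1 = 0 /\ eta2 - xi2 = 0 ->
   forall x_init y_init theta_init alpha_init : R,
   exists x0 y0 : R,
   forall (I : set R) (Hpar Hperp : R -> R) (x y theta alpha : R -> R),
     swimmer_solution l1 l2 xi1 xi2 eta1 eta2 kappa M1 M2
       I Hpar Hperp x y theta alpha ->
     starts_at x y theta alpha x_init y_init theta_init alpha_init ->
     forall t : R, I t ->
       x t = x0 + eta1 * l1 * (l1 * cos (alpha t + theta t)
                               + l2 * cos (theta t))
                  / (2 * (eta1 * l1 + eta2 * l2)) /\
       y t = y0 + eta1 * l1 * (l1 * sin (alpha t + theta t)
                               + l2 * sin (theta t))
                  / (2 * (eta1 * l1 + eta2 * l2)))
  /\
  ((3 + 4 * (l2 / l1) + (eta2 * l2 ^+ 2) / (eta1 * l1 ^+ 2)) * M1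
   - (3 + 4 * (l1 / l2) + (eta1 * l1 ^+ 2) / (eta2 * l2 ^+ 2)) * M2 = 0 ->
   forall (I : set R) (Hpar Hperp : R -> R) (x y theta alpha : R -> R),
     swimmer_solution l1 l2 xi1 xi2 eta1 eta2 kappa M1 M2
       I Hpar Hperp x y theta alpha ->
     alpha 0 = 0 ->
     forall t : R, I t -> alpha t = 0).
Proof.
split=> [[xi1E xi2E] x_init y_init theta_init alpha_init|].
- have {xi1E}-> : xi1 = eta1 by apply/esym/subr0_eq.
  have {xi2E}-> : xi2 = eta2 by apply/esym/subr0_eq.
  have D0 : eta1 * l1 + eta2 * l2 != 0 by rewrite gt_eqF// addr_gt0 ?mulr_gt0.
  pose K := eta1 * l1 / (2 * (eta1 * l1 + eta2 * l2)).
  exists (x_init - K * (l1 * cos (alpha_init + theta_init)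
                        + l2 * cos theta_init)).
  exists (y_init - K * (l1 * sin (alpha_init + theta_init)
                        + l2 * sin theta_init)).
  move=> I Hpar Hperp x y theta alpha sol [<- <- th0 al0] t It.
  have [[_ I0] _ _ _ _] := sol.
  have [cth sth] := cos_sin_same_angle th0.
  have [cal sal] := cos_sin_same_angle al0.
  have [Ex Ey] := isotropic_position D0 sol I0 It.
  rewrite -/K in Ex Ey.
  rewrite cosD sinD -cth -sth -cal -sal -cosD -sinD.
  by split; rewrite ?Ex ?Ey /K mulrAC subrK.
- move=> hM I Hpar Hperp x y theta alpha sol al0 t It.
  have [[_ I0] _ _ _ _] := sol.
  exact: (straight_invariant l1_gt0 l2_gt0 xi1_gt0 xi2_gt0 eta1_gt0 eta2_gt0
    (ltW kappa_gt0) hM sol I0 It al0).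
Qed.
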